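(* Let $\Gamma$ and $\Delta$ be two composable planar networks of rank $n$. Then the piecewise linear map $M\Gamma\Delta:\mathbb{T}^{E(\Gamma\circ\Delta)}\to\mathbb{T}^{VT}$ satisfies $$\mathrm{im}(M\Gamma\Delta)\subset\overline{\mathcal{C}_3}\cap\{t^0_0=0\},$$ with closure taken in $\mathbb{T}^{VT}$.
   Context: A planar network consists of a finite graph $\Gamma$, reals $a<b$, and an embedding of $\Gamma$ in the strip $\{a\le x\le b\}$ with each edge a straight segment not parallel to the $y$-axis; vertices on $x=a$ are sources, on $x=b$ sinks, others internal; edges are oriented left to right. A multipath is a subgraph (same embedding) each of whose vertices internal in $\Gamma$ has in- and out-degree $1$; a multipath with $k$ sources is a $k$-path; $P_k\Gamma$ is the set of $k$-paths. A network has rank $n$ if its sources and sinks are exactly $(a,j)$ and $(b,j)$, $j=1,\dots,n$. Networks $(\Gamma,[a,b])$ and $(\Delta,[a',b'])$ are composable if $a'=b$ and the sources of $\Delta$ are among the sinks of $\Gamma$; then $\Gamma\circ\Delta$ is the planar network on $[a,b']$ obtained as the union of the two graphs. For $n\ge k\ge i\ge 0$, $P^k_i$ is the set of subnetworks $\gamma\cup\delta$ of $\Gamma\circ\Delta$ with $\gamma\in P_k\Gamma$, $\delta\in P_i\Delta$, and the sources of $\delta$ among the sinks of $\gamma$. $\mathbb{T}=\mathbb{R}\cup\{-\infty\}$ with the topology of $[-\infty,\infty)$. For a weighting $\epsilon\in\mathbb{T}^{E(\Gamma\circ\Delta)}$ and a subgraph $\alpha$, $w_\alpha(\epsilon)=\sum_{e\in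 E\alpha}\epsilon(e)$ ($0$ if no edges); $m^k_i(\epsilon)=\max_{\alpha\in P^k_i}w_\alpha(\epsilon)$ ($-\infty$ if $P^k_i=\emptyset$). $VT=\{(k,i):0\le i\le k\le n\}$ with coordinates $t^k_i$, and $M\Gamma\Delta$ is given by $t^k_i=m^k_i$. $\mathcal{C}_3\subset\mathbb{R}^{VT}$ is the polyhedral cone defined, for $0<i\le k<n$, by $t^{k+1}_{i}+t^{k}_{i-1}\ge t^{k+1}_{i-1}+t^{k}_{i}$, $t^{k+1}_{i}+t^{k}_{i}\ge t^{k+1}_{i+1}+t^{k}_{i-1}$, and $t^{k}_{i}+t^{k}_{i-1}\ge t^{k+1}_{i}+t^{k-1}_{i-1}$.
   Formalization: Multipaths are also required to have out-degree 1 at their sources and in-degree 1 at their sinks (disjoint source-to-sink paths); with a degree condition only at internal vertices, the third inequality of the cone can fail. *)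

(* Defs.v *)
From mathcomp Require Import all_boot all_order all_algebra.
From mathcomp Require Import finmap ring lra.
From mathcomp Require Import mathcomp_extra boolp classical_sets functions.
From mathcomp Require Import reals ereal topology normedtype.

Set Implicit Arguments.
Unset Strict Implicit.
Unset Printing Implicit Defensive.

Import Order.TTheory GRing.Theory Num.Theory.
Local Open Scope classical_set_scope.
Local Open Scope ring_scope.

Definition point (R : realType) := (R * R)%type.

(* A straight edge is determined by its end points; it is oriented from the
   first to the second.  As the edges of an embedded graph are segments, no two
   edges share both end points, so a set of pairs of points is enough. *)
Definition edge (R : realType) := (point R * point R)%type.

Definition graph (R : realType) := ({fset point R} * {fset edge R})%type.

Section Graphs.
Variable R : realType.
Implicit Types (G H : graph R) (e : edge R) (p v : point R).

Definition verts G : {fset point R} := G.1.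
Definition edges G : {fset edge R} := G.2.

Definition on_edge p e : Prop :=
  exists t : R, [/\ 0 <= t <= 1,
    p.1 = (1 - t) * e.1.1 + t * e.2.1 & p.2 = (1 - t) * e.1.2 + t * e.2.2].

Definition graph_union G H : graph R :=
  ((verts G `|` verts H)%fset, (edges G `|` edges H)%fset).

Definition subgraphs G : {fset graph R} :=
  [fset H in (fpowerset (verts G) `*` fpowerset (edges G))%fset
    | [forall e : edges H, ((val e).1 \in verts H) && ((val e).2 \in verts H)]]%fset.

Definition in_degree G v : nat := #|` [fset e in edges G | e.2 == v]%fset|.
Definition out_degree G v : nat := #|` [fset e in edges G | e.1 == v]%fset|.

End Graphs.

Record network (R : realType) := Network {
  left_end : R;
  right_end : R;
  network_graph :> graph R;
  left_lt_right : left_end < right_end;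
  verts_in_strip : forall v, v \in verts network_graph ->
    left_end <= v.1 <= right_end;
  edge_ends : forall e, e \in edges network_graph ->
    e.1 \in verts network_graph /\ e.2 \in verts network_graph;
  edge_left_to_right : forall e, e \in edges network_graph -> e.1.1 < e.2.1;
  vertex_on_edge : forall v e,
    v \in verts network_graph -> e \in edges network_graph ->
    on_edge v e -> v = e.1 \/ v = e.2;
  edges_meet_at_ends : forall e f p,
    e \in edges network_graph -> f \in edges network_graph -> e != f ->
    on_edge p e -> on_edge p f ->
    (p = e.1 \/ p = e.2) /\ (p = f.1 \/ p = f.2) }.

Section Networks.
Variable R : realType.
Implicit Types (Gam Del : network R) (al : graph R).

Definition sources Gam al : {fset point R} :=
  [fset v in verts al | v.1 == left_end Gam]%fset.
Definition sinks Gam al : {fset point R} :=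
  [fset v in verts al | v.1 == right_end Gam]%fset.

(* Disjoint unions of paths from sources to sinks: besides having in- and
   out-degree 1 at the internal vertices, a multipath has out-degree 1 at its
   sources and in-degree 1 at its sinks.  Without the latter, isolated sources
   and sinks would be allowed, several paths could share an end point, and the
   maximal weights could fall outside the closure of [cone3]. *)
Definition multipath Gam al : bool :=
  [forall v : verts al,
    ((val v \notin sources Gam al) ==> (in_degree al (val v) == 1%N)) &&
    ((val v \notin sinks Gam al) ==> (out_degree al (val v) == 1%N))].

Definition kpaths Gam (k : nat) : {fset graph R} :=
  [fset al in subgraphs Gam | multipath Gam al & #|` sources Gam al| == k]%fset.

Definition has_rank (n : nat) Gam : Prop :=
  sources Gam Gam = [fset (left_end Gam, j%:R) | j in iota 1 n]%fset /\
  sinks Gam Gam = [fset (right_end Gam, j%:R) | j in iota 1 n]%fset.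

Definition composable Gam Del : Prop :=
  left_end Del = right_end Gam /\
  (sources Del Del `<=` sinks Gam Gam)%fset.

Lemma on_edge_between (p : point R) (e : edge R) :
  e.1.1 < e.2.1 -> on_edge p e -> e.1.1 <= p.1 <= e.2.1.
Proof. by move=> lte [t [/andP[t0 t1] -> _]]; apply/andP; split; nra. Qed.

Lemma on_edge_left (p : point R) (e : edge R) :
  e.1.1 < e.2.1 -> on_edge p e -> p.1 = e.1.1 -> p = e.1.
Proof.
move=> lte [t [_ p1 p2]] pe.
have t0 : t = 0.
  have /eqP : t * (e.2.1 - e.1.1) = 0 by move: p1; rewrite pe; lra.
  by rewrite mulf_eq0 subr_eq0 (gt_eqF lte) orbF => /eqP.
move: p1 p2; rewrite t0 subr0 !mul1r !mul0r !addr0.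
by case: p {pe} => ? ? /= -> ->; case: e.1.
Qed.

Lemma on_edge_right (p : point R) (e : edge R) :
  e.1.1 < e.2.1 -> on_edge p e -> p.1 = e.2.1 -> p = e.2.
Proof.
move=> lte [t [_ p1 p2]] pe.
have t1 : 1 - t = 0.
  have /eqP : (1 - t) * (e.2.1 - e.1.1) = 0 by move: p1; rewrite pe; lra.
  by rewrite mulf_eq0 [X in _ || X]subr_eq0 (gt_eqF lte) orbF => /eqP.
have {}t1 : t = 1 by apply/esym/eqP; rewrite -subr_eq0 t1.
move: p1 p2; rewrite t1 subrr !mul1r !mul0r !add0r.
by case: p {pe} => ? ? /= -> ->; case: e.2.
Qed.

Section Composition.
Variables (Gam Del : network R) (h : composable Gam Del).

Let U := graph_union Gam Del.

Lemma comp_left_lt_right : left_end Gam < right_end Del.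
Proof.
by rewrite (lt_trans (left_lt_right Gam)) // -h.1 left_lt_right.
Qed.

Lemma comp_verts_in_strip (v : point R) : v \in verts U ->
  left_end Gam <= v.1 <= right_end Del.
Proof.
rewrite in_fsetU => /orP[] /verts_in_strip /andP[l r]; apply/andP; split => //.
- by rewrite (le_trans r) // -h.1 ltW // left_lt_right.
- by rewrite (le_trans _ l) // h.1 ltW // left_lt_right.
Qed.

Lemma comp_edge_ends (e : edge R) : e \in edges U ->
  e.1 \in verts U /\ e.2 \in verts U.
Proof.
rewrite !in_fsetU => /orP[] /edge_ends[-> ->] //; by rewrite !orbT.
Qed.

Lemma comp_edge_left_to_right (e : edge R) : e \in edges U -> e.1.1 < e.2.1.
Proof. by rewrite in_fsetU => /orP[] /edge_left_to_right. Qed.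

Lemma left_edge_at_seam (e : edge R) (p : point R) :
  e \in edges Gam -> on_edge p e -> right_end Gam <= p.1 -> p = e.2.
Proof.
move=> eG pe rp; have lte := edge_left_to_right eG.
have /andP[_ pr] := on_edge_between lte pe.
have /andP[_ er] := verts_in_strip (proj2 (edge_ends eG)).
apply: on_edge_right => //; apply/eqP; rewrite eq_le pr.
exact: le_trans er rp.
Qed.

Lemma right_edge_at_seam (e : edge R) (p : point R) :
  e \in edges Del -> on_edge p e -> p.1 <= right_end Gam -> p = e.1.
Proof.
move=> eD pe rp; have lte := edge_left_to_right eD.
have /andP[pl _] := on_edge_between lte pe.
have /andP[el _] := verts_in_strip (proj1 (edge_ends eD)).
apply: on_edge_left => //; apply/eqP; rewrite eq_le pl andbT.
by rewrite (le_trans rp) // -h.1.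
Qed.

Lemma comp_vertex_on_edge (v : point R) (e : edge R) :
  v \in verts U -> e \in edges U -> on_edge v e -> v = e.1 \/ v = e.2.
Proof.
rewrite !in_fsetU => /orP[vG|vD] /orP[eG|eD] ve.
- exact: (vertex_on_edge vG eG ve).
- left; apply: right_edge_at_seam => //.
  by have /andP[] := verts_in_strip vG.
- right; apply: left_edge_at_seam => //.
  by have /andP[+ _] := verts_in_strip vD; rewrite h.1.
- exact: (vertex_on_edge vD eD ve).
Qed.

Lemma seam (e f : edge R) (p : point R) :
  e \in edges Gam -> f \in edges Del -> on_edge p e -> on_edge p f ->
  p = e.2 /\ p = f.1.
Proof.
move=> eG fD pe pf.
have /andP[_ pe2] := on_edge_between (edge_left_to_right eG) pe.
have /andP[pf1 _] := on_edge_between (edge_left_to_right fD) pf.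
have /andP[_ er] := verts_in_strip (proj2 (edge_ends eG)).
have /andP[fl _] := verts_in_strip (proj1 (edge_ends fD)).
split; first by apply: left_edge_at_seam => //; rewrite -h.1 (le_trans fl).
by apply: right_edge_at_seam => //; exact: le_trans pe2 er.
Qed.

Lemma comp_edges_meet_at_ends (e f : edge R) (p : point R) :
  e \in edges U -> f \in edges U -> e != f -> on_edge p e -> on_edge p f ->
  (p = e.1 \/ p = e.2) /\ (p = f.1 \/ p = f.2).
Proof.
rewrite !in_fsetU => /orP[eG|eD] /orP[fG|fD] ef pe pf.
- exact: (edges_meet_at_ends eG fG).
- by have [? ?] := seam eG fD pe pf; split; [right|left].
- by have [? ?] := seam fG eD pf pe; split; [left|right].
- exact: (edges_meet_at_ends eD fD).
Qed.

Definition comp : network R := Network comp_left_lt_right comp_verts_in_strip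
  comp_edge_ends comp_edge_left_to_right comp_vertex_on_edge
  comp_edges_meet_at_ends.

End Composition.

Definition comp_paths Gam Del (k i : nat) : {fset graph R} :=
  [fset graph_union gam del | gam in kpaths Gam k,
     del in [fset d in kpaths Del i | (sources Del d `<=` sinks Gam gam)%fset]]%fset.

End Networks.

(* The tropical line [-oo, +oo[; as a [set_type] it carries the topology induced
   by that of \bar R. *)
Definition trop (R : realType) : Type := [set x : \bar R | (x < +oo)%E].

Definition trop_val (R : realType) (x : trop R) : \bar R := set_val x.

Definition mk_trop (R : realType) (x : \bar R) (h : (x < +oo)%E) : trop R :=
  exist _ x (mem_set h).

Definition trop_fin (R : realType) (r : R) : trop R := mk_trop (ltry r).

Section Weights.
Variables (R : realType) (Gam Del : network R) (h : composable Gam Del).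

Definition weighting : Type := edges (comp h) -> trop R.

Definition weight (eps : weighting) (al : graph R) : \bar R :=
  (\sum_(e : edges (comp h) | val e \in edges al) trop_val (eps e))%E.

Definition max_weight (k i : nat) (eps : weighting) : \bar R :=
  \big[maxe/-oo%E]_(al <- comp_paths Gam Del k i) weight eps al.

Lemma max_weight_lty (k i : nat) (eps : weighting) :
  (max_weight k i eps < +oo)%E.
Proof.
rewrite /max_weight; elim/big_ind: _ => [|x y xoo yoo|al _].
- by rewrite ltNye.
- by rewrite gt_max xoo yoo.
- rewrite /weight; elim/big_ind: _ => [|x y|e _].
  + exact: ltry.
  + exact: lte_add_pinfty.
  + exact: (set_mem (valP (eps e))).
Qed.

End Weights.

Definition VT (n : nat) : Type :=
  {p : 'I_n.+1 * 'I_n.+1 | (p.2 <= p.1)%N}.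

(* The index $(k, i)$, for $i \le k \le n$; junk otherwise. *)
Definition vt (n k i : nat) : VT n :=
  insubd (exist (fun p : 'I_n.+1 * 'I_n.+1 => is_true (p.2 <= p.1)%N)
            (ord0, ord0) isT)
         (inord k, inord i).

Definition trop_space (R : realType) (n : nat) : topologicalType :=
  {ptws VT n -> trop R}.

Definition comp_map (R : realType) (n : nat) (Gam Del : network R)
    (h : composable Gam Del) (eps : weighting h) : trop_space R n :=
  fun v => mk_trop (max_weight_lty (val v).1 (val v).2 eps).

Arguments comp_map {R} n {Gam Del} h eps.

Definition cone3 (R : realType) (n : nat) : set (VT n -> R) :=
  [set t | forall k i : nat, (0 < i)%N -> (i <= k)%N -> (k < n)%N ->
    [/\ t (vt n k.+1 i) + t (vt n k i.-1) >=
          t (vt n k.+1 i.-1) + t (vt n k i),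
        t (vt n k.+1 i) + t (vt n k i) >=
          t (vt n k.+1 i.+1) + t (vt n k i.-1)
      & t (vt n k i) + t (vt n k i.-1) >=
          t (vt n k.+1 i) + t (vt n k.-1 i.-1)]].

Arguments cone3 R n : clear implicits.

Definition trop_embed (R : realType) (n : nat) (t : VT n -> R) :
  trop_space R n := fun v => trop_fin (t v).

(* Main.v *)
Require Import Defs.
From mathcomp Require Import all_boot all_order all_algebra.
From mathcomp Require Import finmap ring lra zify.
From mathcomp Require Import mathcomp_extra boolp classical_sets functions.
From mathcomp Require Import reals ereal topology normedtype.
(* Again, to shadow the homonymous lemmas of classical_sets. *)
From mathcomp Require Import finset finmap.

Set Implicit Arguments.
Unset Strict Implicit.
Unset Printing Implicit Defensive.

Import Order.TTheory GRing.Theory Num.Theory.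
Local Open Scope classical_set_scope.
Local Open Scope ring_scope.

(* Split every vertex of the composed network into an in-node and an out-node
   joined by an arc, and let flow leave at the seam through an extra exit node.
   The elements of P^k_i then are the 0/1-flows of value k that send k - i units
   to the exit.  The maximal weights of such flows are M-concave in (k, i), which
   for three terminals is exactly the list of rhombus inequalities of C_3.
   To approximate by finite points of the cone, add arcs from the source straight
   to the exit and to the final sink, so that every (k, i) is feasible, and give
   weight -N to these and to the arcs of weight -oo; the optima are then finite,
   lie in C_3, and tend to M(eps) as N grows. *)

(** * Exchanging arcs between two arc sets *)

Lemma sum_setUI (E : finType) (M : zmodType) (F : E -> M) (X Y : {set E}) :
  \sum_(e in X :|: Y) F e + \sum_(e in X :&: Y) F e =
  \sum_(e in X) F e + \sum_(e in Y) F e.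
Proof.
have hY : \sum_(e in X :|: Y) F e = \sum_(e in Y) F e + \sum_(e in X :\: Y) F e.
  by rewrite (big_setID Y) /= setIUl setIid setDUl setDv setU0 (setUidPr (subsetIr X Y)).
rewrite hY [X0 in _ = X0 + _](big_setID Y) /= [LHS]addrC -[RHS]addrA.
by congr (_ + _); exact: addrC.
Qed.

Section Exchange.
Variables (V : eqType) (E : finType) (src tgt : E -> V).
Implicit Types X Y : {set E}.

Definition charge (v : V) (e : E) : int := (src e == v)%:R - (tgt e == v)%:R.

Definition divergence X v : int := \sum_(e in X) charge v e.

Lemma divergenceD1 X e v : e \in X ->
  divergence (X :\ e) v = divergence X v - charge v e.
Proof. by move=> eX; rewrite /divergence (big_setD1 e eX) /=; ring. Qed.

Lemma divergenceU1 X e v : e \notin X ->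
  divergence (e |: X) v = divergence X v + charge v e.
Proof. by move=> eX; rewrite /divergence big_setU1 //= addrC. Qed.

Lemma divergenceUI X Y X' Y' v :
  X' :|: Y' = X :|: Y -> X' :&: Y' = X :&: Y ->
  divergence X' v + divergence Y' v = divergence X v + divergence Y v.
Proof. by move=> hU hI; rewrite /divergence -sum_setUI hU hI sum_setUI. Qed.

(** Arcs common to [X] and [Y] cancel, so a strict inequality needs an arc of [X :\: Y] with
    positive charge at [s] or an arc of [Y :\: X] with negative charge there; loops have charge
    0. *)
Lemma divergence_lt_edge X Y s : divergence Y s < divergence X s ->
  exists e, (e \in X :\: Y) && (src e == s) && (tgt e != s) ||
            (e \in Y :\: X) && (tgt e == s) && (src e != s).
Proof.
move=> lt; apply/existsP; apply: contraLR lt => /existsPn h; rewrite -leNgt.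
rewrite /divergence (big_setID Y) /= [leRHS](big_setID X) /= setIC lerD2l.
apply: (@le_trans _ _ 0).
- apply: sumr_le0 => e eXY; have := h e; rewrite /= eXY /charge /=.
  by case: eqP; case: eqP.
- apply: sumr_ge0 => e eYX; have := h e; rewrite /= eYX orbC /charge /=.
  by case: eqP; case: eqP.
Qed.

(* Follow arcs of the symmetric difference from s, swapping them between X and Y
   and never using one twice, until a node where X has a deficit is met. *)
Lemma exchange X Y s : divergence Y s < divergence X s ->
  exists t X' Y', [/\ divergence X t < divergence Y t,
    X' :|: Y' = X :|: Y, X' :&: Y' = X :&: Y &
    forall v, divergence X' v = divergence X v - (s == v)%:R + (t == v)%:R].
Proof.
have [m] := ubnP #|(X :\: Y) :|: (Y :\: X)|; elim: m X Y s => // m IH X Y s.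
rewrite ltnS => cm /[dup] lt /divergence_lt_edge[e /orP[]] /andP[/andP[]].
- rewrite inE => /andP[eY eX] /eqP es et.
  have ltm : (#|(X :\ e :\: Y) :|: (Y :\: (X :\ e))| < m)%N.
    apply: leq_trans cm; apply: proper_card; apply/properP; split.
      apply/fintype.subsetP => f; rewrite !inE.
      by have [->|] := eqVneq f e; rewrite ?(negbTE eY) ?eX //= ?andbF.
    by exists e; rewrite !inE eX (negbTE eY) ?eqxx.
  have [ltt|get] := ltP (divergence X (tgt e)) (divergence Y (tgt e)).
    exists (tgt e), (X :\ e), (e |: Y); split=> //.
    + by rewrite setUA (setUC _ [set e]) setD1K.
    + apply/setP => f; rewrite !inE.
      by have [->|] := eqVneq f e; rewrite ?(negbTE eY) ?andbF.
    + by move=> v; rewrite divergenceD1 // /charge es; ring.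
  (* For the induction [e] belongs to neither set, so it cannot be used twice; it is given to [Y']
     only afterwards. Its removal from [X] makes the surplus at [tgt e] strict. *)
  have [|t [X' [Y' [ltt hU hI hX]]]] := IH _ _ (tgt e) ltm.
    by rewrite divergenceD1 // /charge es eqxx eq_sym (negbTE et); lia.
  have eXY : e \notin X' :|: Y' by rewrite hU !inE eqxx (negbTE eY).
  exists t, X', (e |: Y'); split.
  (* Removing [e] changes the divergence of [X] only at the ends of [e], and creates a deficit at
     neither: [s] had a surplus of at least 1, and [tgt e] gains 1. So [t] is another node, and its
     deficit is one of [X] itself. *)
  + move: ltt; rewrite divergenceD1 // /charge es.
    have [<-|_] := eqVneq s t; first by rewrite (negbTE et); lia.
    have [<-|_] := eqVneq (tgt e) t; last by lia.
    by rewrite leNgt in get; lia.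
  + by rewrite setUCA hU setUA setD1K.
  + apply/setP => f; have /setP/(_ f) := hI; have := eXY; rewrite !inE.
    by have [->|] := eqVneq f e; rewrite //= (negbTE eY) andbF => /norP[/negbTE ->].
  + by move=> v; rewrite hX divergenceD1 // /charge es; ring.
(* The mirror case: an arc of [Y] entering [s] is traversed backwards and handed to [X]. *)
- rewrite inE => /andP[eX eY] /eqP es et.
  have ltm : (#|(X :\: (Y :\ e)) :|: (Y :\ e :\: X)| < m)%N.
    apply: leq_trans cm; apply: proper_card; apply/properP; split.
      apply/fintype.subsetP => f; rewrite !inE.
      by have [->|] := eqVneq f e; rewrite ?(negbTE eX) ?eY //= ?andbF.
    by exists e; rewrite !inE eY (negbTE eX) ?eqxx.
  have [ltt|get] := ltP (divergence X (src e)) (divergence Y (src e)).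
    exists (src e), (e |: X), (Y :\ e); split=> //.
    + by rewrite setUAC setD1K // setUC.
    + apply/setP => f; rewrite !inE.
      by have [->|] := eqVneq f e; rewrite ?(negbTE eX) ?andbF.
    + by move=> v; rewrite divergenceU1 // /charge es; ring.
  have [|t [X' [Y' [ltt hU hI hX]]]] := IH _ _ (src e) ltm.
    by rewrite divergenceD1 // /charge es eqxx eq_sym (negbTE et); lia.
  have eXY : e \notin X' :|: Y' by rewrite hU !inE eqxx (negbTE eX).
  exists t, (e |: X'), Y'; split.
  + move: ltt; rewrite divergenceD1 // /charge es.
    have [<-|_] := eqVneq s t; first by rewrite (negbTE et); lia.
    have [<-|_] := eqVneq (src e) t; last by lia.
    by rewrite leNgt in get; lia.
  + by rewrite -setUA hU setUCA setD1K.
  + apply/setP => f; have /setP/(_ f) := hI; have := eXY; rewrite !inE.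
    by have [->|] := eqVneq f e; rewrite //= (negbTE eX) => /norP[_ /negbTE ->].
  + move=> v; rewrite divergenceU1; last by move: eXY; rewrite inE => /norP[].
    by rewrite hX /charge es; ring.
Qed.

End Exchange.

(** * Convergence in the tropical space *)

Lemma cvg_initial (I : Type) (F : set_system I) (FF : Filter F) (S : choiceType)
    (T : topologicalType) (f : S -> T) (u : I -> S) (s : S) :
  f \o u @ F --> f s -> u @ F --> (s : initial_topology f).
Proof.
move=> cv A [_ [[B oB <-] Bs BA]].
have /cv FB : nbhs (f s) B by apply: open_nbhs_nbhs.
by rewrite /nbhs /= in FB *; apply: filterS FB => i /BA.
Qed.

(** The pointwise topology and the topology of [trop] are both built from initial topologies, so
    convergence can be tested on the coordinates, in the extended reals. *)
Lemma cvg_trop_space (R : realType) (n : nat) (I : Type) (F : set_system I)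
    (FF : Filter F) (u : I -> trop_space R n) (t : trop_space R n) :
  (forall v, (fun i => trop_val (u i v)) @ F --> trop_val (t v)) ->
  u @ F --> t.
Proof.
move=> cv; apply/cvg_sup => v.
apply: cvg_initial => /=.
by apply: (@cvg_initial _ _ _ _ _ (@set_val _ [set x : \bar R | (x < +oo)%E])); apply: cv.
Qed.

Lemma vtK n k i : (i <= k)%N -> (k <= n)%N ->
  ((val (vt n k i)).1 = k :> nat) /\ ((val (vt n k i)).2 = i :> nat).
Proof.
move=> ik kn; have kn' : (i <= n)%N by apply: leq_trans ik kn.
by rewrite /vt val_insubd ifT /= !inordK.
Qed.

Lemma trop_val_lty (R : realType) (t : trop R) : (trop_val t < +oo)%E.
Proof. exact: (set_mem (valP t)). Qed.

Lemma fineK_trop (R : realType) (t : trop R) :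
  trop_val t != -oo%E -> (fine (trop_val t))%:E = trop_val t.
Proof. by move=> tN; rewrite fineK // fin_numE tN lt_eqF // trop_val_lty. Qed.

(** * Counting in finite sets *)

(** Turns degrees and numbers of sources or exits into sums over arcs, to be matched term by term
    with a divergence. *)
Lemma card_imfset_val (T : choiceType) (K : {fset T}) (P : pred K) (Q : pred T) :
  #|` [fset x in [fset val e | e : K & P e] | Q x]%fset| =
  (\sum_(e | P e) (Q (val e) : nat))%N.
Proof.
have -> : [fset x in [fset val e | e : K & P e] | Q x]%fset =
    [fset val e | e in [pred e : K | P e && Q (val e)]]%fset.
  apply/fsetP => x; rewrite !inE /=; apply/andP/imfsetP => /= [[]|[e]].
    by move=> /imfsetP[e /= Pe ->] Qe; exists e => //; apply/andP.
  by move=> /andP[Pe Qe] ->; split=> //; apply/imfsetP; exists e.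
rewrite card_imfset /=; last exact: val_inj.
rewrite -cardE -sum1_card [RHS](big_mkcond P) [LHS]big_mkcond /=.
by apply: eq_bigr => e _ /=; rewrite unfold_in /=; case: (P e); case: (Q _).
Qed.

(** Lets a membership indicator be read as a cardinality, so that [card_imfset_val] applies to it as
    well. *)
Lemma card_fset_eq (T : choiceType) (A : {fset T}) (P : pred T) x :
  #|` [fset y in A | P y && (y == x)]%fset| = (x \in A) && P x.
Proof.
have [/andP[xA Px]|nx] := boolP (_ && _).
  suff -> : [fset y in A | P y && (y == x)]%fset = [fset x]%fset by rewrite cardfs1.
  by apply/fsetP => y; rewrite !inE /=; have [->|_] := eqVneq y x; rewrite ?andbF ?xA ?Px.
apply/eqP; rewrite cardfs_eq0; apply/eqP/fsetP => y; rewrite !inE /=.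
by have [->|_] := eqVneq y x; rewrite ?andbF // andbT (negbTE nx).
Qed.

Lemma imfset_val (T : choiceType) (A K : {fset T}) (P : pred K) :
  (A `<=` K)%fset -> (forall x : K, P x = (val x \in A)) ->
  [fset val x | x : K & P x]%fset = A.
Proof.
move=> /fsubsetP AK PA; apply/fsetP => x; apply/imfsetP/idP => /= [[y Py ->]|xA].
  by rewrite -PA; exact: Py.
by exists [` AK _ xA]%fset => //; rewrite -[_ \in _]/(P _) PA.
Qed.

(** * The split network and its flows *)

Section SplitNetwork.
Variables (R : realType) (n : nat) (Gam Del : network R) (h : composable Gam Del).

(* [None] is the final sink: its divergence is never prescribed, being determined
   by the others. *)
Definition node : eqType := option (bool + bool * Defs.point R)%type.

Definition source_node : node := Some (inl true).
Definition exit_node : node := Some (inl false).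
Definition in_node (v : Defs.point R) : node := Some (inr (false, v)).
Definition out_node (v : Defs.point R) : node := Some (inr (true, v)).

(* In order: the edges of the network, the arcs splitting its vertices (which
   replace the in-node of a source of Gam by [source_node] and the out-node of a
   sink of Del by [None]), the exits at the seam, and the bypass arcs. *)
Definition split_arc : finType :=
  (edges (Defs.comp h) + (verts (Defs.comp h) + (sinks Gam Gam + 'I_n * bool)))%type.

Definition src (a : split_arc) : node :=
  match a with
  | inl e => out_node (val e).1
  | inr (inl v) =>
      if (val v).1 == left_end Gam then source_node else in_node (val v)
  | inr (inr (inl v)) => out_node (val v)
  | inr (inr (inr _)) => source_node
  end.

Definition tgt (a : split_arc) : node :=
  match a with
  | inl e => in_node (val e).2
  | inr (inl v) =>
      if (val v).1 == right_end Del then None else out_node (val v)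
  | inr (inr (inl _)) => exit_node
  | inr (inr (inr (_, b))) => if b then exit_node else None
  end.

Implicit Types (X Y : {set split_arc}).

Definition flow_graph X : graph R :=
  ([fset val v | v : verts (Defs.comp h) & inr (inl v) \in X]%fset,
   [fset val e | e : edges (Defs.comp h) & inl e \in X]%fset).

Definition exits X : {fset Defs.point R} :=
  [fset val v | v : sinks Gam Gam & inr (inr (inl v)) \in X]%fset.

Definition bypass X : {set 'I_n * bool} := [set j | inr (inr (inr j)) \in X].

Definition div X v := divergence src tgt X v.

Lemma divE X v : div X v =
  \sum_(e : edges (Defs.comp h) | inl e \in X) charge src tgt v (inl e) +
  (\sum_(u : verts (Defs.comp h) | inr (inl u) \in X) charge src tgt v (inr (inl u)) +
  (\sum_(z : sinks Gam Gam | inr (inr (inl z)) \in X) charge src tgt v (inr (inr (inl z))) +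
   \sum_(j | inr (inr (inr j)) \in X) charge src tgt v (inr (inr (inr j))))).
Proof. by rewrite /div /divergence !big_sumType. Qed.

(** The splitting arc of a vertex on the left side leaves [source_node] instead. Setting this
    divergence to 0 thus forces in-degree 1 at the chosen vertices off the left side and 0
    elsewhere: the multipath condition. *)
Lemma div_in_node X v : div X (in_node v) =
  ((v \in verts (flow_graph X)) && (v.1 != left_end Gam))%:R
  - (in_degree (flow_graph X) v)%:R.
Proof.
rewrite divE -(@card_fset_eq _ _ (fun x => x.1 != left_end Gam)) /in_degree.
rewrite !card_imfset_val !natr_sum -sumrN.
rewrite [\sum_(z : sinks Gam Gam | _) _]big1 //.
rewrite [\sum_(j | inr (inr (inr j)) \in X) _]big1 ?addr0; last by case=> j [].
rewrite addrC; congr (_ + _); apply: eq_bigr => u _; rewrite /charge /=.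
- by case: (_ == left_end Gam); case: (_ == right_end Del) => //=; rewrite subr0.
- by rewrite sub0r.
Qed.

(** At divergence 0, a chosen vertex off the right side is left either by one edge or by its exit,
    never by both. *)
Lemma div_out_node X v : div X (out_node v) =
  (out_degree (flow_graph X) v)%:R + (v \in exits X)%:R -
  ((v \in verts (flow_graph X)) && (v.1 != right_end Del))%:R.
Proof.
rewrite divE -(@card_fset_eq _ _ (fun x => x.1 != right_end Del)) /out_degree.
have -> : (v \in exits X) = #|` [fset y in exits X | y == v]%fset| :> nat.
  by rewrite (@card_fset_eq _ _ xpredT) andbT.
rewrite !card_imfset_val !natr_sum -sumrN.
rewrite [\sum_(j | inr (inr (inr j)) \in X) _]big1 ?addr0; last by case=> j [].
rewrite [X0 in _ + X0]addrC addrA; congr (_ + _ + _); apply: eq_bigr => u _; rewrite /charge /=.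
- by rewrite subr0.
- by rewrite subr0.
- by case: (_ == left_end Gam); case: (_ == right_end Del) => //=; rewrite sub0r.
Qed.

Lemma div_source_node X : bypass X = set0 ->
  div X source_node = #|` sources Gam (flow_graph X)|%:R.
Proof.
move=> /setP bX; rewrite divE /sources card_imfset_val natr_sum.
rewrite big1 ?add0r //.
rewrite [\sum_(z : sinks Gam Gam | _) _]big1 //.
rewrite [\sum_(j | inr (inr (inr j)) \in X) _]big1 ?addr0; last first.
  by move=> j; have := bX j; rewrite !inE => ->.
apply: eq_bigr => u _; rewrite /charge /=.
by case: (_ == left_end Gam); case: (_ == right_end Del).
Qed.

Lemma div_exit_node X : bypass X = set0 ->
  div X exit_node = - #|` exits X|%:R.
Proof.
move=> /setP bX; rewrite divE.
have -> : exits X = [fset y in exits X | xpredT y]%fset.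
  by apply/fsetP => y; rewrite !inE andbT.
rewrite card_imfset_val natr_sum -sumrN.
rewrite big1 ?add0r // big1 ?add0r; last first.
  by move=> u _; rewrite /charge /=; case: (_ == left_end Gam); case: (_ == right_end Del).
rewrite [\sum_(j | inr (inr (inr j)) \in X) _]big1 ?addr0; last first.
  by move=> j; have := bX j; rewrite !inE => ->.
by [].
Qed.

(** Divergence is outflow minus inflow, whence the sign at the exit, which absorbs [k - i] units.
    The indices are integers because exchanges shift them by 1 in either direction. *)
Definition demand (k i : int) (x : (bool + bool * Defs.point R)%type) : int :=
  match x with
  | inl true => k
  | inl false => i - k
  | inr _ => 0
  end.

Definition flow (k i : int) : pred {set split_arc} :=
  fun X => `[< forall x, div X (Some x) = demand k i x >].

Lemma flowP k i X :
  reflect (forall x, div X (Some x) = demand k i x) (flow k i X).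
Proof. exact: asboolP. Qed.

(** This is [exchange] read through demands; the divergences of [Y'] follow because the two sets
    keep their total divergence at every node. If the walk ends at [None], no inequality of demands
    is available. *)
Lemma flow_exchange k1 i1 k2 i2 X Y s : flow k1 i1 X -> flow k2 i2 Y ->
  demand k2 i2 s < demand k1 i1 s ->
  exists t X' Y', [/\ X' :|: Y' = X :|: Y, X' :&: Y' = X :&: Y,
    forall x, t = Some x -> demand k1 i1 x < demand k2 i2 x,
    forall x, div X' (Some x) = demand k1 i1 x - (s == x)%:R + (t == Some x)%:R &
    forall x, div Y' (Some x) = demand k2 i2 x + (s == x)%:R - (t == Some x)%:R].
Proof.
move=> /flowP fX /flowP fY; rewrite -fX -fY => /exchange[t [X' [Y' [lt hU hI hX]]]].
exists t, X', Y'; split=> // [x tx|x|x]; first by rewrite -fX -fY -tx.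
  by rewrite /div hX -fX; congr (_ - _ + _).
have := divergenceUI src tgt (Some x) hU hI; rewrite hX.
rewrite -!/(div _ _) fX fY (inj_eq Some_inj) => /(canRL (addKr _)) ->; ring.
Qed.

Lemma exchange_source k1 i1 k2 i2 X Y :
  flow k1 i1 X -> flow k2 i2 Y -> k2 < k1 ->
  exists X' Y', [/\ X' :|: Y' = X :|: Y, X' :&: Y' = X :&: Y &
    (flow (k1 - 1) (i1 - 1) X' && flow (k2 + 1) (i2 + 1) Y') ||
    [&& i1 - k1 < i2 - k2, flow (k1 - 1) i1 X' & flow (k2 + 1) i2 Y']].
Proof.
move=> fX fY lt; have [] := flow_exchange (s := inl true) fX fY lt.
move=> t [X' [Y' [hU hI ht hX hY]]]; exists X', Y'; split=> //.
case: t ht hX hY => [[[]|v]|] /= ht hX hY; apply/orP.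
- by have := ht _ erefl; rewrite /=; lia.
- right; have := ht _ erefl; rewrite /= => -> /=.
  by apply/andP; split; apply/flowP => x; rewrite ?hX ?hY; case: x => [[]|w] /=; lia.
- by have := ht _ erefl.
- by left; apply/andP; split; apply/flowP => x; rewrite ?hX ?hY; case: x => [[]|w] /=; lia.
Qed.

Lemma exchange_exit k1 i1 k2 i2 X Y :
  flow k1 i1 X -> flow k2 i2 Y -> i2 - k2 < i1 - k1 ->
  exists X' Y', [/\ X' :|: Y' = X :|: Y, X' :&: Y' = X :&: Y &
    (flow k1 (i1 - 1) X' && flow k2 (i2 + 1) Y') ||
    [&& k1 < k2, flow (k1 + 1) i1 X' & flow (k2 - 1) i2 Y']].
Proof.
move=> fX fY lt; have [] := flow_exchange (s := inl false) fX fY lt.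
move=> t [X' [Y' [hU hI ht hX hY]]]; exists X', Y'; split=> //.
case: t ht hX hY => [[[]|v]|] /= ht hX hY; apply/orP.
- right; have := ht _ erefl; rewrite /= => -> /=.
  by apply/andP; split; apply/flowP => x; rewrite ?hX ?hY; case: x => [[]|w] /=; lia.
- by have := ht _ erefl; rewrite /=; lia.
- by have := ht _ erefl.
- by left; apply/andP; split; apply/flowP => x; rewrite ?hX ?hY; case: x => [[]|w] /=; lia.
Qed.

(** A flow on bypass arcs alone, making every pair with [i <= k <= n] feasible: [n] parallel arcs to
    each of the two ends are enough. It is also the default candidate of the maximum in
    [optimum]. *)
Definition bypass_flow (k i : nat) : {set split_arc} :=
  [set a : split_arc | match a with
           | inr (inr (inr (j, b))) => if b then (j < k - i)%N else (j < i)%N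
           | _ => false
           end].

Lemma bypass_flowP (k i : nat) : (i <= k)%N -> (k <= n)%N ->
  flow k i (bypass_flow k i).
Proof.
move=> ik kn; apply/flowP => x; rewrite divE.
rewrite 3?big_pred0 ?add0r; try by move=> u; rewrite inE.
pose G (j : 'I_n) (b : bool) : int :=
  if (if b then (j < k - i)%N else (j < i)%N)
  then charge src tgt (Some x) (inr (inr (inr (j, b)))) else 0.
rewrite big_mkcond /= (eq_bigr (fun p => G p.1 p.2)); last by case=> j b _; rewrite inE.
rewrite -(pair_bigA _ G) /=.
under eq_bigr do rewrite big_bool /= /G /charge /=.
rewrite big_split /= -!big_mkcond /=.
rewrite -(big_ord_widen _ (fun=> _)) ?(leq_trans (leq_subr _ _)) //.
rewrite -(big_ord_widen _ (fun=> _)) ?(leq_trans ik) //.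
rewrite !sumr_const !card_ord; case: x @G => [[]|[]] /=; lia.
Qed.

End SplitNetwork.

(** * Counting edges, sources and sinks of multipaths *)

Section Kpaths.
Variables (R : realType).
Implicit Types (N : network R) (al be : graph R) (v : Defs.point R) (e : edge R).

Lemma in_kpathsP N k al :
  reflect [/\ (verts al `<=` verts N)%fset, (edges al `<=` edges N)%fset,
    forall e, e \in edges al -> e.1 \in verts al /\ e.2 \in verts al,
    forall v, v \in verts al ->
      (v.1 != left_end N -> in_degree al v = 1%N) /\
      (v.1 != right_end N -> out_degree al v = 1%N) &
    #|` sources N al| = k] (al \in kpaths N k).
Proof.
rewrite /kpaths /subgraphs !inE /= !fpowersetE.
apply: (iffP andP) => [[/andP[/andP[sV sE] /forallP ends] /andP[/forallP mp /eqP ck]]|].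
  split=> // [e eal|v val]; first by apply/andP; exact: (ends [` eal]%fset).
  have /andP[] := mp [` val]%fset; rewrite !inE /= val /= => /implyP ml /implyP mr.
  by split=> [/ml|/mr] /eqP.
move=> [sV sE ends mp <-].
rewrite -[al.1]/(verts al) -[al.2]/(edges al) sV sE eqxx /=.
split; last rewrite andbT; apply/forallP.
  by move=> e; apply/andP; apply: ends; exact: valP.
move=> v; have [ml mr] := mp _ (valP v).
by rewrite !inE /= (valP v) /=; apply/andP; split; apply/implyP; [move=> /ml|move=> /mr] => ->.
Qed.

Lemma in_degree_gt0 al e : e \in edges al -> (0 < in_degree al e.2)%N.
Proof.
by move=> eal; rewrite cardfs_gt0; apply/fset0Pn; exists e; rewrite !inE eal eqxx.
Qed.

Lemma out_degree_gt0 al e : e \in edges al -> (0 < out_degree al e.1)%N.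
Proof.
by move=> eal; rewrite cardfs_gt0; apply/fset0Pn; exists e; rewrite !inE eal eqxx.
Qed.

Lemma eq_in_degree al be v :
  (forall e, e.2 = v -> (e \in edges al) = (e \in edges be)) ->
  in_degree al v = in_degree be v.
Proof.
move=> ab; congr #|` _|; apply/fsetP => e; rewrite !inE.
by have [/ab ->|] := eqVneq e.2 v; rewrite ?andbF.
Qed.

Lemma eq_out_degree al be v :
  (forall e, e.1 = v -> (e \in edges al) = (e \in edges be)) ->
  out_degree al v = out_degree be v.
Proof.
move=> ab; congr #|` _|; apply/fsetP => e; rewrite !inE.
by have [/ab ->|] := eqVneq e.1 v; rewrite ?andbF.
Qed.

Lemma in_degree0 al v : (forall e, e.2 = v -> e \notin edges al) -> in_degree al v = 0%N.
Proof.
move=> nv; apply/eqP; rewrite cardfs_eq0; apply/eqP/fsetP => e; rewrite !inE.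
by have [/nv/negbTE ->|] := eqVneq e.2 v; rewrite ?andbF.
Qed.

Lemma out_degree0 al v : (forall e, e.1 = v -> e \notin edges al) -> out_degree al v = 0%N.
Proof.
move=> nv; apply/eqP; rewrite cardfs_eq0; apply/eqP/fsetP => e; rewrite !inE.
by have [/nv/negbTE ->|] := eqVneq e.1 v; rewrite ?andbF.
Qed.

(** Mapping an edge to its head is a bijection onto the non-sources, since these have in-degree 1
    and no edge ends on the left side; tails and non-sinks are symmetric. *)
Lemma card_kpath_edges N k al : al \in kpaths N k ->
  #|` edges al| = #|` verts al `\` sources N al|%fset /\
  #|` edges al| = #|` verts al `\` sinks N al|%fset.
Proof.
move=> /in_kpathsP[sV sE ends mp _].
have lr e : e \in edges al -> e.1.1 < e.2.1.
  by move=> eal; apply: (@edge_left_to_right _ N); exact: fsubsetP eal.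
have strip v : v \in verts al -> left_end N <= v.1 <= right_end N.
  by move=> val; apply: verts_in_strip; exact: fsubsetP val.
have nsrc e : e \in edges al -> e.2.1 != left_end N.
  move=> eal; have [/strip/andP[l _] _] := ends _ eal.
  by rewrite gt_eqF // (le_lt_trans l) // lr.
have nsnk e : e \in edges al -> e.1.1 != right_end N.
  move=> eal; have [_ /strip/andP[_ r]] := ends _ eal.
  by rewrite lt_eqF // (lt_le_trans _ r) // lr.
split.
- have -> : (verts al `\` sources N al)%fset = [fset e.2 | e in edges al]%fset.
    apply/fsetP => v; rewrite !inE; apply/andP/imfsetP => /= [[ns val]|[e eal ->]].
      rewrite val /= in ns; have [/(_ ns) d1 _] := mp _ val.
      have : (0 < in_degree al v)%N by rewrite d1.
      rewrite cardfs_gt0 => /fset0Pn[e]; rewrite !inE /= => /andP[eal /eqP <-].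
      by exists e.
    have [_ e2] := ends _ eal.
    by rewrite e2 nsrc.
  rewrite card_in_imfset //= => e f eal fal ef.
  have [_ e2] := ends _ eal; have [/(_ (nsrc _ eal)) d1 _] := mp _ e2.
  have /eqP/cardfs1P[x /fsetP hx] := d1.
  have := hx e; have := hx f; rewrite !inE /= eal fal ef !eqxx /=.
  by move=> /esym/eqP -> /esym/eqP ->.
- have -> : (verts al `\` sinks N al)%fset = [fset e.1 | e in edges al]%fset.
    apply/fsetP => v; rewrite !inE; apply/andP/imfsetP => /= [[ns val]|[e eal ->]].
      rewrite val /= in ns; have [_ /(_ ns) d1] := mp _ val.
      have : (0 < out_degree al v)%N by rewrite d1.
      rewrite cardfs_gt0 => /fset0Pn[e]; rewrite !inE /= => /andP[eal /eqP <-].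
      by exists e.
    have [e1 _] := ends _ eal.
    by rewrite e1 nsnk.
  rewrite card_in_imfset //= => e f eal fal ef.
  have [e1 _] := ends _ eal; have [_ /(_ (nsnk _ eal)) d1] := mp _ e1.
  have /eqP/cardfs1P[x /fsetP hx] := d1.
  have := hx e; have := hx f; rewrite !inE /= eal fal ef !eqxx /=.
  by move=> /esym/eqP -> /esym/eqP ->.
Qed.

Lemma card_sinks_kpath N k al : al \in kpaths N k -> #|` sinks N al| = k.
Proof.
move=> alk; have [] := card_kpath_edges alk; have /in_kpathsP[_ _ _ _ <-] := alk.
have s1 : (sources N al `<=` verts al)%fset by apply/fsubsetP => v; rewrite !inE => /andP[].
have s2 : (sinks N al `<=` verts al)%fset by apply/fsubsetP => v; rewrite !inE => /andP[].
rewrite !cardfsDS // => ->.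
have := fsubset_leq_card s1; have := fsubset_leq_card s2.
move: #|` _| #|` _| #|` _| => *; lia.
Qed.

(** Otherwise take an edge whose tail is leftmost: not being a source, this tail has an incoming
    edge, whose own tail lies further left. *)
Lemma kpath0_edges N al : al \in kpaths N 0 -> edges al = fset0.
Proof.
move=> /in_kpathsP[sV sE ends mp /eqP]; rewrite cardfs_eq0 => /eqP/fsetP s0.
apply/eqP/negPn/negP => /fset0Pn[e0 e0al].
have [e _ emin] := Order.TotalTheory.arg_minP (fun e : edges al => (val e).1.1)
  (i0 := [` e0al]%fset) (P := xpredT) isT.
have [e1 _] := ends _ (valP e).
have ns : (val e).1.1 != left_end N.
  by have := s0 (val e).1; rewrite !inE /= e1 /= => ->.
have [/(_ ns) d1 _] := mp _ e1.
have : (0 < in_degree al (val e).1)%N by rewrite d1.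
rewrite cardfs_gt0 => /fset0Pn[f]; rewrite !inE /= => /andP[fal /eqP fe].
have := emin [` fal]%fset isT; rewrite /= leNgt -fe => /negP; apply.
by apply: (@edge_left_to_right _ N); exact: fsubsetP fal.
Qed.

End Kpaths.

(** * Elements of P^k_i as flows without bypass arcs *)

Section Correspondence.
Variables (R : realType) (n : nat) (Gam Del : network R) (h : composable Gam Del).

Local Notation split_arc := (split_arc n h).
Local Notation a := (left_end Gam).
Local Notation b := (right_end Gam).
Local Notation c := (right_end Del).

Definition flow_of (al : graph R) (Z : {fset Defs.point R}) : {set split_arc} :=
  [set x : split_arc | match x with
                 | inl e => val e \in edges al
                 | inr (inl v) => val v \in verts al
                 | inr (inr (inl z)) => val z \in Z
                 | inr (inr (inr _)) => false
                 end].

Lemma flow_ofK al Z :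
  (verts al `<=` verts (Defs.comp h))%fset -> (edges al `<=` edges (Defs.comp h))%fset ->
  flow_graph (flow_of al Z) = al.
Proof.
case: al => V E /= sV sE; congr (_, _); apply: imfset_val => //= x; by rewrite inE.
Qed.

Lemma exits_flow_of al Z : (Z `<=` sinks Gam Gam)%fset -> exits (flow_of al Z) = Z.
Proof. by move=> sZ; apply: imfset_val => // x; rewrite inE. Qed.

Lemma bypass_flow_of al Z : bypass (flow_of al Z) = set0.
Proof. by apply/setP => j; rewrite !inE. Qed.

Let ab : a < b. Proof. exact: left_lt_right. Qed.
Let bc : b < c. Proof. rewrite -h.1; exact: left_lt_right. Qed.

Let GV v : v \in verts Gam -> v.1 <= b.
Proof. by move/verts_in_strip/andP => []. Qed.
Let DV v : v \in verts Del -> b <= v.1.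
Proof. by rewrite -h.1 => /verts_in_strip/andP[]. Qed.
Let GE1 e : e \in edges Gam -> e.1.1 < b.
Proof.
by move=> eG; rewrite (lt_le_trans (edge_left_to_right eG)) // GV //; case: (edge_ends eG).
Qed.
Let GE2 e : e \in edges Gam -> e.2.1 <= b.
Proof. by move=> /edge_ends[_ /GV]. Qed.
Let DE1 e : e \in edges Del -> b <= e.1.1.
Proof. by move=> /edge_ends[/DV]. Qed.
Let DE2 e : e \in edges Del -> b < e.2.1.
Proof.
by move=> eG; rewrite (le_lt_trans _ (edge_left_to_right eG)) // DV //; case: (edge_ends eG).
Qed.

(** Flow exits at the sinks of the left multipath that are not sources of the right one. There are
    [k - i] of them because a [k]-path also has [k] sinks. *)
Lemma flow_of_comp_path (k i : nat) al : al \in comp_paths Gam Del k i -> (i <= k)%N ->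
  exists X : {set split_arc}, [/\ flow k i X, bypass X = set0 & flow_graph X = al].
Proof.
move=> /imfset2P[/= ga gak [de]]; rewrite inE => /andP[dei sd] -> ik {al}.
have snk := card_sinks_kpath gak.
have /in_kpathsP[gV gE gends gmp gsrc] := gak.
have /in_kpathsP[dV dE dends dmp dsrc] := dei.
set Z := (sinks Gam ga `\` sources Del de)%fset.
set al := graph_union ga de.
have sZ : (Z `<=` sinks Gam Gam)%fset.
  apply/fsubsetP => v; rewrite !inE => /andP[_ /andP[/(fsubsetP gV) vG vb]].
  by rewrite vG.
have sV : (verts al `<=` verts (Defs.comp h))%fset by apply: fsetUSS.
have sE : (edges al `<=` edges (Defs.comp h))%fset by apply: fsetUSS.
pose X := flow_of al Z.
have gX : flow_graph X = al by apply: flow_ofK.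
have zX : exits X = Z by apply: exits_flow_of.
have bX : bypass X = set0 by apply: bypass_flow_of.
have inal e : (e \in edges al) = (e \in edges ga) || (e \in edges de) by rewrite !inE.
have vinal v : (v \in verts al) = (v \in verts ga) || (v \in verts de) by rewrite !inE.
have gaG := fsubsetP gV; have deD := fsubsetP dV.
have gaE := fsubsetP gE; have deE := fsubsetP dE.
have seam v : v \in verts de -> v \notin verts ga -> b < v.1.
  move=> vd; rewrite lt_neqAle (DV (deD _ vd)) andbT; apply: contraNN => /eqP vb.
  have /(fsubsetP sd) : v \in sources Del de by rewrite !inE vd /= h.1 vb eqxx.
  by rewrite !inE => /andP[].
exists X; split=> //; apply/flowP => -[[]|[[] v]] /=.
- rewrite div_source_node // gX -gsrc natz; congr Posz.
  congr #|` _|; apply/fsetP => v; rewrite !inE.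
  have [va|_] := eqVneq v.1 a; last by rewrite !andbF.
  rewrite !andbT orb_idr // => /deD/DV; rewrite va; by rewrite leNgt ab.
- rewrite div_exit_node // zX cardfsDS // snk dsrc natrB //; lia.
- rewrite -/(out_node v) div_out_node gX zX vinal.
  have [vg|vg] := boolP (v \in verts ga).
    have [_ gout] := gmp _ vg; have vb := GV (gaG _ vg).
    have vc : v.1 != c by rewrite lt_eqF // (le_lt_trans vb).
    rewrite vc /= !inE vg /= h.1.
    have [veb|vnb] := eqVneq v.1 b.
      (* At the seam only edges of [de] can leave [v]: one does if [v] is a source of [de], and
         otherwise [v] lies in [Z] and has an exit. *)
      rewrite andbT [out_degree _ _](_ : _ = out_degree de v); last first.
        apply: eq_out_degree => e ev; rewrite inal orb_idl // => /gaE/GE1.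
        by rewrite ev veb ltxx.
      have [vd|vd] /= := boolP (v \in verts de).
        by have [_ ->] := dmp _ vd.
      rewrite out_degree0 // => e ev; apply: contraNN vd => /dends[].
      by rewrite ev.
    rewrite andbF [out_degree _ _](_ : _ = out_degree ga v); first by rewrite gout.
    apply: eq_out_degree => e ev; rewrite inal orb_idr // => /deE/DE1.
    by rewrite ev => bv; move: vnb; rewrite eq_le vb bv.
  have vZ : v \in Z = false by rewrite !inE (negbTE vg) /= andbF.
  rewrite vZ /= addr0.
  have [vd|vd] /= := boolP (v \in verts de); last first.
    rewrite out_degree0 // => e ev; rewrite inal negb_or; apply/andP; split.
      by apply: contraNN vg => /gends[]; rewrite ev.
    by apply: contraNN vd => /dends[]; rewrite ev.
  rewrite [out_degree _ _](_ : _ = out_degree de v); last first.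
    apply: eq_out_degree => e ev; rewrite inal orb_idl // => /gends[].
    by rewrite ev (negbTE vg).
  have [_ dout] := dmp _ vd.
  have [vc|/dout -> //] := eqVneq v.1 c.
  rewrite out_degree0 // => e ev; apply/negP => ede.
  have := edge_left_to_right (deE _ ede); rewrite ev vc.
  have [_ /verts_in_strip/andP[_ ec]] := edge_ends (deE _ ede).
  by rewrite ltNge ec.
- rewrite -/(in_node v) div_in_node gX vinal.
  have [vg|vg] := boolP (v \in verts ga).
    have [gin _] := gmp _ vg; have vb := GV (gaG _ vg).
    rewrite [in_degree _ _](_ : _ = in_degree ga v); last first.
      apply: eq_in_degree => e ev; rewrite inal orb_idr // => /deE/DE2.
      by rewrite ev ltNge vb.
    have [va|/gin -> //] := eqVneq v.1 a.
    rewrite in_degree0 // => e ev; apply/negP => ega.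
    have := edge_left_to_right (gaE _ ega); rewrite ev va.
    have [/verts_in_strip/andP[ea _] _] := edge_ends (gaE _ ega).
    by rewrite ltNge ea.
  have [vd|vd] /= := boolP (v \in verts de); last first.
    rewrite in_degree0 // => e ev; rewrite inal negb_or; apply/andP; split.
      by apply: contraNN vg => /gends[]; rewrite ev.
    by apply: contraNN vd => /dends[]; rewrite ev.
  have vb := seam _ vd vg.
  rewrite [in_degree _ _](_ : _ = in_degree de v); last first.
    apply: eq_in_degree => e ev; rewrite inal orb_idl // => /gends[].
    by rewrite ev (negbTE vg).
  have [din _] := dmp _ vd.
  by rewrite din ?h.1 ?gt_eqF // (lt_trans ab).
Qed.

(** The graph of the flow is cut at the seam into its parts in [Gam] and [Del]. Comparing edges is
    enough, as weights depend on nothing else. *)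
Lemma comp_path_of_flow (k i : nat) (X : {set split_arc}) : flow k i X -> bypass X = set0 ->
  (i <= k)%N ->
  exists2 al, al \in comp_paths Gam Del k i & edges al = edges (flow_graph X).
Proof.
move=> /flowP fX bX ik.
set V := verts (flow_graph X); set A := edges (flow_graph X); set Z := exits X.
have Hin v : (v \in V) && (v.1 != a) = in_degree (flow_graph X) v :> nat.
  have := fX (inr (false, v)); rewrite -/(in_node v) div_in_node -/V /=.
  by move=> /eqP; rewrite subr_eq0 eqr_nat => /eqP.
have Hout v : (out_degree (flow_graph X) v + (v \in Z))%N = (v \in V) && (v.1 != c).
  have := fX (inr (true, v)); rewrite -/(out_node v) div_out_node -/V -/Z /=.
  by move=> /eqP; rewrite -natrD subr_eq0 eqr_nat => /eqP.
have HS : #|` sources Gam (flow_graph X)| = k.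
  by have := fX (inl true); rewrite /= div_source_node // natz => -[].
have HZ : #|` Z| = (k - i)%N.
  by have := fX (inl false); rewrite /= div_exit_node // -/Z natz; move: #|` Z| => z; lia.
have sV v : v \in V -> (v \in verts Gam) || (v \in verts Del).
  by move=> /imfsetP[/= u _ ->]; have := valP u; rewrite inE.
have sA e : e \in A -> (e \in edges Gam) || (e \in edges Del).
  by move=> /imfsetP[/= u _ ->]; have := valP u; rewrite inE.
have sZ v : v \in Z -> (v \in verts Gam) /\ v.1 = b.
  by move=> /imfsetP[/= u _ ->]; have := valP u; rewrite !inE => /andP[-> /eqP].
have ZV v : v \in Z -> v \in V.
  by move=> vZ; have := Hout v; rewrite vZ; case: (v \in V) => //=; lia.
have A1 e : e \in A -> e.1 \in V /\ e.1 \notin Z.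
  move=> eA; have := Hout e.1; case: (out_degree _ _) (out_degree_gt0 eA) => // d _.
  by case: (_ \in V); case: (_ \in Z); case: (_ != c) => //=; rewrite addn1.
have A2 e : e \in A -> e.2 \in V.
  by move=> eA; have := in_degree_gt0 eA; rewrite -Hin; case: (_ \in V).
pose ga : graph R := ([fset v in V | v \in verts Gam], [fset e in A | e \in edges Gam])%fset.
(* A vertex in [Z] has no outgoing edge, so as a source of [de] it would violate the multipath
   condition. *)
pose de : graph R := ([fset v in V | (v \in verts Del) && (v \notin Z)],
  [fset e in A | e \in edges Del])%fset.
have gak : ga \in kpaths Gam k.
  apply/in_kpathsP; split.
  - by apply/fsubsetP => v; rewrite !inE => /andP[].
  - by apply/fsubsetP => v; rewrite !inE => /andP[].
  - move=> e; rewrite !inE => /andP[eA /edge_ends[-> ->]].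
    by have [-> _] := A1 _ eA; rewrite A2.
  - move=> v; rewrite !inE => /andP[vV vG]; have vb := GV vG; split=> [va|vnb].
      rewrite [LHS](_ : _ = in_degree (flow_graph X) v); first by rewrite -Hin vV va.
      apply: eq_in_degree => e ev; rewrite !inE andb_idr // => /sA/orP[//|/DE2].
      by rewrite ev ltNge vb.
    rewrite [LHS](_ : _ = out_degree (flow_graph X) v).
      have := Hout v; rewrite vV lt_eqF ?(le_lt_trans vb) //=.
      by case: (boolP (v \in Z)) => [/sZ[_ /eqP]|_ <-]; rewrite ?(negbTE vnb) ?addn0.
    apply: eq_out_degree => e ev; rewrite !inE andb_idr // => /sA/orP[//|/DE1].
    by rewrite ev => bv; move: vnb; rewrite eq_le vb bv.
  - rewrite -HS; congr #|` _|; apply/fsetP => v; rewrite !inE.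
    have [va|_] := eqVneq v.1 a; last by rewrite !andbF.
    rewrite !andbT andb_idr // => /sV/orP[//|/DV].
    by rewrite va leNgt ab.
have snk := card_sinks_kpath gak.
have src_de : sources Del de = (sinks Gam ga `\` Z)%fset.
  apply/fsetP => v; rewrite !inE h.1.
  have [vb|_] := eqVneq v.1 b; last by rewrite !andbF.
  rewrite !andbT; apply/andP/andP => [[vV /andP[vD vZ]]|[vZ /andP[vV vG]]].
    have /(fsubsetP h.2) : v \in sources Del Del by rewrite !inE vD h.1 vb eqxx.
    by rewrite !inE => /andP[-> _]; rewrite vZ vV.
  (* With no exit at [v], balance yields an edge leaving it. Edges of [Gam] start strictly left of
     the seam, so this edge, and with it [v], belongs to [Del]. *)
  have := Hout v; rewrite vV vb lt_eqF // (negbTE vZ) addn0 /= => d1.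
  have : (0 < out_degree (flow_graph X) v)%N by rewrite d1.
  rewrite cardfs_gt0 => /fset0Pn[e]; rewrite !inE /= => /andP[eA /eqP ev].
  have /orP[/GE1|/edge_ends[]] := sA _ eA; rewrite ev ?vb ?ltxx // => -> _.
  by [].
have dei : de \in kpaths Del i.
  apply/in_kpathsP; split.
  - by apply/fsubsetP => v; rewrite !inE => /and3P[].
  - by apply/fsubsetP => v; rewrite !inE => /andP[].
  - move=> e; rewrite !inE => /andP[eA eD]; have [-> ->] := edge_ends eD.
    have [-> ->] := A1 _ eA; rewrite A2 //=; split=> //; apply/negP => /sZ[_ e2b].
    by have := DE2 eD; rewrite e2b ltxx.
  - move=> v; rewrite !inE h.1 => /and3P[vV vD vZ]; have vb := DV vD; split=> [vnb|vc].
      rewrite [LHS](_ : _ = in_degree (flow_graph X) v).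
        by rewrite -Hin vV gt_eqF // (lt_le_trans ab).
      apply: eq_in_degree => e ev; rewrite !inE andb_idr // => /sA/orP[/GE2|//].
      by rewrite ev => bv; move: vnb; rewrite eq_le vb bv.
    rewrite [LHS](_ : _ = out_degree (flow_graph X) v).
      by have := Hout v; rewrite vV vc (negbTE vZ) addn0.
    apply: eq_out_degree => e ev; rewrite !inE andb_idr // => /sA/orP[/GE1|//].
    by rewrite ev ltNge vb.
  - have ZG : (Z `<=` sinks Gam ga)%fset.
      apply/fsubsetP => v vZ; have [vG vb] := sZ _ vZ.
      by rewrite !inE ZV // vG vb eqxx.
    by rewrite src_de cardfsDS // snk HZ subKn.
exists (graph_union ga de).
  apply/imfset2P; exists ga => //; exists de => //.
  rewrite inE; apply/andP; split; first exact: dei.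
  rewrite src_de.
  exact: fsubsetDl.
apply/fsetP => e; rewrite !inE -andb_orr andb_idr //; exact: sA.
Qed.

End Correspondence.

(** * Optimal penalized flows and their limits *)

Section MaximalFlows.
Variables (R : realType) (n : nat) (Gam Del : network R) (h : composable Gam Del).
Variable eps : weighting h.

Local Notation split_arc := (split_arc n h).
Implicit Types X Y : {set split_arc}.

(** [fine] sends -oo to 0; an edge of weight -oo is charged through [arc_bad] instead. *)
Definition arc_cost (x : split_arc) : R :=
  if x is inl e then fine (trop_val (eps e)) else 0.

Definition arc_bad (x : split_arc) : bool :=
  match x with
  | inl e => trop_val (eps e) == -oo%E
  | inr (inr (inr _)) => true
  | _ => false
  end.

Definition cost (X : {set split_arc}) : R := \sum_(x in X) arc_cost x.

(* The number of arcs that get weight -N. *)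
Definition bad (X : {set split_arc}) : nat := (\sum_(x in X) arc_bad x)%N.

Definition penalized_cost (N : R) (X : {set split_arc}) : R :=
  \sum_(x in X) (arc_cost x - N * (arc_bad x)%:R).

Definition optimum (N : R) (k i : nat) : R :=
  penalized_cost N
    [arg max_(X > bypass_flow n h k i | flow k i X) penalized_cost N X]%O.

Lemma penalized_costE N X : penalized_cost N X = cost X - N * (bad X)%:R.
Proof. by rewrite /penalized_cost sumrB -mulr_sumr natr_sum. Qed.

Lemma optimumP N (k i : nat) : (i <= k)%N -> (k <= n)%N ->
  (exists2 X, flow k i X & optimum N k i = penalized_cost N X) /\
  (forall X, flow k i X -> penalized_cost N X <= optimum N k i).
Proof.
move=> ik kn; rewrite /optimum.
case: Order.TotalTheory.arg_maxP; first exact: bypass_flowP.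
by move=> X fX maxX; split=> [|Y fY]; [exists X | exact: maxX].
Qed.

Lemma optimum_ge N (K I : int) (k i : nat) X : flow K I X -> (i <= k)%N -> (k <= n)%N ->
  K = k%:Z -> I = i%:Z -> penalized_cost N X <= optimum N k i.
Proof.
by move=> fX ik kn Kk Ii; apply: (optimumP N ik kn).2; rewrite -Kk -Ii.
Qed.

Lemma penalized_costUI N X Y X' Y' :
  X' :|: Y' = X :|: Y -> X' :&: Y' = X :&: Y ->
  penalized_cost N X + penalized_cost N Y = penalized_cost N X' + penalized_cost N Y'.
Proof. by move=> hU hI; rewrite /penalized_cost -sum_setUI -hU -hI sum_setUI. Qed.

(** The flow for [(k+1, i-1)] sends two units more to the exit than the one for [(k, i)]. Whether
    the walk from the exit ends at the source or at the final sink, the new flows are for [(k+1, i)]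
    and [(k, i-1)]. *)
Lemma optimum_rhombus1 N (k i : nat) : (0 < i)%N -> (i <= k)%N -> (k < n)%N ->
  optimum N k.+1 i.-1 + optimum N k i <= optimum N k.+1 i + optimum N k i.-1.
Proof.
move=> i0 ik kn.
have [||[X fX ->] _] := @optimumP N k.+1 i.-1; try lia.
have [||[Y fY ->] _] := @optimumP N k i; try lia.
have [|X' [Y' [hU hI /orP[/andP[fX' fY']|/and3P[_ fX' fY']]]]] := exchange_exit fY fX.
- lia.
- rewrite addrC (penalized_costUI N hU hI) addrC.
  by apply: lerD; apply: optimum_ge; eauto; lia.
- rewrite addrC (penalized_costUI N hU hI).
  by apply: lerD; apply: optimum_ge; eauto; lia.
Qed.

(** Here the flow with the surplus at the source also has the larger demand at the exit, so the walk
    can only end at the final sink. *)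
Lemma optimum_rhombus2 N (k i : nat) : (0 < i)%N -> (i <= k)%N -> (k < n)%N ->
  optimum N k.+1 i.+1 + optimum N k i.-1 <= optimum N k.+1 i + optimum N k i.
Proof.
move=> i0 ik kn.
have [||[X fX ->] _] := @optimumP N k.+1 i.+1; try lia.
have [||[Y fY ->] _] := @optimumP N k i.-1; try lia.
have [|X' [Y' [hU hI /orP[/andP[fX' fY']|/and3P[lt fX' fY']]]]] := exchange_source fX fY.
- lia.
- rewrite (penalized_costUI N hU hI) addrC.
  by apply: lerD; apply: optimum_ge; eauto; lia.
- exfalso; lia.
Qed.

(** Both possible ends of the walk from the source produce the same two index pairs, in opposite
    order. *)
Lemma optimum_rhombus3 N (k i : nat) : (0 < i)%N -> (i <= k)%N -> (k < n)%N ->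
  optimum N k.+1 i + optimum N k.-1 i.-1 <= optimum N k i + optimum N k i.-1.
Proof.
move=> i0 ik kn.
have [||[X fX ->] _] := @optimumP N k.+1 i; try lia.
have [||[Y fY ->] _] := @optimumP N k.-1 i.-1; try lia.
have [|X' [Y' [hU hI /orP[/andP[fX' fY']|/and3P[_ fX' fY']]]]] := exchange_source fX fY.
- lia.
- rewrite (penalized_costUI N hU hI) addrC.
  by apply: lerD; apply: optimum_ge; eauto; lia.
- rewrite (penalized_costUI N hU hI).
  by apply: lerD; apply: optimum_ge; eauto; lia.
Qed.

Lemma optimum_cone3 N :
  cone3 R n (fun v : VT n => optimum N (val v).1 (val v).2).
Proof.
have E k i : (i <= k)%N -> (k <= n)%N ->
    optimum N (val (vt n k i)).1 (val (vt n k i)).2 = optimum N k i.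
  by move=> ik kn; have [-> ->] := vtK ik kn.
move=> k i i0 ik kn; rewrite !E; try lia.
by split; [exact: optimum_rhombus1|exact: optimum_rhombus2|exact: optimum_rhombus3].
Qed.

Lemma mem_flow_graph X (e : edges (Defs.comp h)) :
  (val e \in edges (flow_graph X)) = (inl e \in X).
Proof.
apply/imfsetP/idP => /= [[f fX /val_inj ->]|eX]; first exact: fX.
by exists e.
Qed.

Lemma bad0P X : reflect (bypass X = set0 /\
    forall e, inl e \in X -> trop_val (eps e) != -oo%E) (bad X == 0%N).
Proof.
rewrite /bad sum_nat_eq0; apply: (iffP forallP) => [b0|[/setP bX eX] x].
  split=> [|e eX]; last by have /implyP/(_ eX) := b0 (inl e); rewrite /= eqb0.
  apply/setP => j; rewrite !inE; apply/negP => jX.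
  by have /implyP/(_ jX) := b0 (inr (inr (inr j))).
apply/implyP => xX; case: x xX => [e /eX|[//|[//|j jX]]]; first by rewrite /= eqb0.
by have := bX j; rewrite !inE jX.
Qed.

Lemma weight_flow X al : bad X == 0%N -> edges al = edges (flow_graph X) ->
  weight eps al = (cost X)%:E.
Proof.
move=> /bad0P[_ eX] alX.
rewrite /weight /cost big_sumType /= [X0 in (_ + X0)]big1 // addr0 -sumEFin.
apply: eq_big => e; first by rewrite alX mem_flow_graph.
by rewrite alX mem_flow_graph => /eX/fineK_trop.
Qed.

Lemma bad_of_weight X al : weight eps al != -oo%E -> edges al = edges (flow_graph X) ->
  bypass X = set0 -> bad X == 0%N.
Proof.
move=> wal alX bX; apply/bad0P; split=> // e eX; apply: contraNN wal => eN.
rewrite /weight; apply/eqP/esum_eqNyP; exists e; split; [exact: mem_index_enum| |exact/eqP].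
by rewrite alX mem_flow_graph.
Qed.

Definition total_cost : R := \sum_x `|arc_cost x|.

Lemma normr_cost X : `|cost X| <= total_cost.
Proof.
apply: le_trans (ler_norm_sum _ _ _) _.
by rewrite /total_cost [leRHS](bigID (mem X)) /= lerDl sumr_ge0.
Qed.

(** A flow with a bad arc costs at most [total_cost - N], hence at most [- total_cost] for such [N],
    and cannot beat a flow without bad arcs. The latter correspond to the elements of P^k_i of
    finite weight. *)
Lemma optimum_near (k i : nat) (N : R) : (i <= k)%N -> (k <= n)%N ->
  (total_cost *+ 2 <= N) ->
  (max_weight k i eps = -oo%E -> optimum N k i <= total_cost - N) /\
  (max_weight k i eps != -oo%E -> (optimum N k i)%:E = max_weight k i eps).
Proof.
move=> ik kn CN.
have C0 : 0 <= total_cost by apply: sumr_ge0.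
have [[X fX eX] opt] := optimumP N ik kn.
have le0 Y : flow k i Y -> bad Y == 0%N -> ((cost Y)%:E <= max_weight k i eps)%E.
  move=> fY /[dup] /bad0P[bY _] b0; have [al alk alY] := comp_path_of_flow fY bY ik.
  by rewrite -(weight_flow b0 alY); apply: le_bigmax_seq.
have le1 Y : bad Y != 0%N -> penalized_cost N Y <= total_cost - N.
  rewrite -lt0n => bY; rewrite penalized_costE; apply: lerB.
    exact: le_trans (ler_norm _) (normr_cost _).
  by rewrite ler_peMr ?ler1n //; lra.
split=> mN.
  rewrite eX; have [b0|/le1 //] := boolP (bad X == 0%N).
  by have := le0 _ fX b0; rewrite mN leeNy_eq.
(* A maximum different from its default value -oo is attained. *)
have [al alk alm] : exists2 al, al \in comp_paths Gam Del k i & weight eps al = max_weight k i eps.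
  suff [al alk <-] : exists2 al, al \in enum_fset (comp_paths Gam Del k i) &
      weight eps al = max_weight k i eps by exists al.
  move: mN; rewrite /max_weight; elim: (enum_fset _) => [|al s IH]; first by rewrite big_nil eqxx.
  rewrite big_cons; case: leP => [_ /IH[be bes <-]|_ _].
    by exists be => //; rewrite in_cons bes orbT.
  by exists al => //; rewrite in_cons eqxx.
have [Y [fY bY gY]] := flow_of_comp_path n h alk ik.
have b0 : bad Y == 0%N by apply: (bad_of_weight (al := al)); rewrite ?gY ?alm.
have mY : (cost Y)%:E = max_weight k i eps by rewrite -alm (weight_flow b0) // gY.
apply/eqP; rewrite eq_le; apply/andP; split; last first.
  rewrite -mY lee_fin; apply: le_trans (opt _ fY).
  by rewrite penalized_costE (eqP b0) mulr0 subr0.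
have [bX|/le1 leX] := boolP (bad X == 0%N).
  by rewrite eX penalized_costE (eqP bX) mulr0 subr0; exact: le0.
rewrite eX -mY lee_fin; apply: le_trans leX _.
have := normr_cost Y; rewrite ler_norml => /andP[]; lra.
Qed.

(** The optima are eventually constant if the limit is finite, and bounded by [total_cost - N]
    otherwise. *)
Lemma optimum_cvg (k i : nat) : (i <= k)%N -> (k <= n)%N ->
  (fun N : nat => (optimum N%:R k i)%:E) @ \oo --> max_weight k i eps.
Proof.
move=> ik kn; have [mN|mN] := eqVneq (max_weight k i eps) -oo%E.
  rewrite mN; apply/cvgeNyPle => A; near=> N.
  have : total_cost *+ 2 <= N%:R by near: N; exact: nbhs_infty_ger.
  rewrite lee_fin => /(optimum_near ik kn)[/(_ mN) + _] => /le_trans; apply.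
  have : total_cost - A <= N%:R by near: N; exact: nbhs_infty_ger.
  lra.
apply: cvg_near_cst; near=> N.
have : total_cost *+ 2 <= N%:R by near: N; exact: nbhs_infty_ger.
by move=> /(optimum_near ik kn)[_ /(_ mN)].
Unshelve. all: by end_near.
Qed.

Lemma max_weight00 : max_weight 0 0 eps = 0%E.
Proof.
have w0 al : al \in comp_paths Gam Del 0 0 -> weight eps al = 0%E.
  move=> /imfset2P[/= ga gak [de]]; rewrite inE => /andP[dei _] ->.
  rewrite /weight big1 // => e.
  by rewrite inE /= (kpath0_edges gak) (kpath0_edges dei) !inE.
(* P^0_0 must be nonempty, or the maximum would be -oo. An element comes from [bypass_flow n h 0 0],
   which is the empty set of arcs. *)
have [al alk _] : exists2 al, al \in comp_paths Gam Del 0 0 &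
    edges al = edges (flow_graph (bypass_flow n h 0 0)).
  apply: comp_path_of_flow => //; first exact: bypass_flowP.
  by apply/setP => -[j []]; rewrite !inE.
apply/eqP; rewrite eq_le; apply/andP; split.
  by rewrite /max_weight big_seq; apply: bigmax_le => [|be /w0 ->]; rewrite ?leNye.
by rewrite -(w0 _ alk); apply: le_bigmax_seq.
Qed.

End MaximalFlows.

Theorem theorem4p6 (R : realType) (n : nat) (Gam Del : network R)
    (rank_Gam : has_rank n Gam) (rank_Del : has_rank n Del)
    (h : composable Gam Del) :
  range (comp_map n h) `<=`
    closure (@trop_embed R n @` cone3 R n) `&`
    [set t : trop_space R n | t (vt n 0 0) = trop_fin 0].
Proof.
move=> _ [eps _ <-]; split; last first.
  have [k0 i0] := @vtK n 0 0 isT isT.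
  by apply: val_inj => /=; rewrite k0 i0 max_weight00.
pose t (N : nat) (v : VT n) := optimum n eps N%:R (val v).1 (val v).2.
(* A closed set contains the limits of its sequences, so it remains to see that each [t N] lies in
   the cone and that the coordinates converge. *)
apply: (@closed_cvg _ _ \oo _ (fun N => trop_embed (t N)) _ (@closed_closure _ _)).
  apply: nearW => N; apply: subset_closure; exists (t N) => //.
  exact: optimum_cone3.
apply: cvg_trop_space => v.
apply: optimum_cvg; first exact: valP v.
by rewrite -ltnS.
Qed.
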